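(* Assume that the following two conditions hold. (Random sampling) The data $X_i$, $i=1,\dots,n$, are i.i.d. copies of the $\mathcal{S}$-valued random variable $X$. (Regular partial order) For $\bar p\in(0,1)$ there is a positive number $v(\bar p)$ such that $$\sup_{x\in\mathcal{S},\,p_x\ge\bar p}\left|\frac{\mathbb{P}_n(X_i\preccurlyeq x)-P(X\preccurlyeq x)}{p_x}\right|\vee\left|\frac{\mathbb{P}_n(X_i\succcurlyeq x)-P(X\succcurlyeq x)}{p_x}\right|\vee\left|\frac{\hat p_x-p_x}{p_x}\right|\lesssim_P\sqrt{v(\bar p)/n}.$$ Then for any $\bar p\in(0,1)$, $$\sup_{x\in\mathcal{S},\,p_x\ge\bar p}|\hat\tau_x-\tau_x|\lesssim_P\sqrt{v(\bar p)/n}.$$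
   Context: $X$ is a random variable on a probability space $(\Omega,\mathcal{A},P)$ with values in an arbitrary set $\mathcal{S}$ equipped with a partial order $\preccurlyeq$ (and $x\succcurlyeq y$ means $y\preccurlyeq x$); the events $\{X\succcurlyeq x\}$ and $\{X\preccurlyeq x\}$ are measurable for all $x\in\mathcal{S}$. The set of points comparable with $x$ is $\mathcal{C}(x)=\{y\in\mathcal{S}: y\succcurlyeq x\text{ or }y\preccurlyeq x\}$, and $p_x=P(X\in\mathcal{C}(x))$ is the probability of comparison. The partial quantile index of $x$ is $\tau_x=P(X\preccurlyeq x\mid X\in\mathcal{C}(x))$. $\mathbb{P}_n(A)=\frac1n\sum_{i=1}^n 1\{X_i\in A\}$; $\mathbb{P}_n(A\mid B)=\mathbb{P}_n(A\cap B)/\mathbb{P}_n(B)$ if $\mathbb{P}_n(B)>0$ and zero otherwise. $\hat p_x=\mathbb{P}_n(\mathcal{C}(x))$ and $\hat\tau_x=\mathbb{P}_n(X_i\preccurlyeq x\mid\mathcal{C}(x))$. $a\vee b=\max\{a,b\}$. Asymptotics are as $n\to\infty$; $a\lesssim_P b$ means $a=O_P(b)$. The quantities $\bar p$ and $v(\bar p)$ are allowed to depend on $n$. *)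

(* Defs.v *)
From HB Require Import structures.
From mathcomp Require Import all_boot all_order all_algebra.
From mathcomp Require Import finmap.
From mathcomp Require Import all_classical all_reals all_analysis.

Set Implicit Arguments.
Unset Strict Implicit.
Unset Printing Implicit Defensive.

Import Order.TTheory GRing.Theory Num.Theory.
Import numFieldNormedType.Exports.

Local Open Scope classical_set_scope.
Local Open Scope ring_scope.

Section order_sets.
Context {dS : Order.disp_t} {S : porderType dS}.

Definition up_set (x : S) : set S := [set y | (x <= y)%O].

Definition down_set (x : S) : set S := [set y | (y <= x)%O].

Definition comparable_set (x : S) : set S := [set y | (x >=< y)%O].

(* No sigma-algebra is given on S, so events about an S-valued map are
   those of the sigma-algebra generated by the up-sets and the down-sets; a
   map into S is measurable for it iff the preimages of the generators are
   measurable. *)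
Definition order_sigma_algebra : set (set S) :=
  <<s range up_set `|` range down_set >>.

End order_sets.

Section random_elements.
Context {d : measure_display} {Omega : measurableType d}.
Context {dS : Order.disp_t} {S : porderType dS}.
Context {R : realType} (P : probability Omega R).

Definition order_measurable (X : Omega -> S) : Prop :=
  forall x, measurable (X @^-1` up_set x) /\ measurable (X @^-1` down_set x).

Definition same_law (X Y : Omega -> S) : Prop :=
  forall A, order_sigma_algebra A -> P (X @^-1` A) = P (Y @^-1` A).

Definition mutually_independent (Xs : nat -> Omega -> S) : Prop :=
  forall (J : {fset nat}) (A : nat -> set S),
    (forall i, i \in J -> order_sigma_algebra (A i)) ->
    P (\bigcap_(i in [set` J]) (Xs i @^-1` A i)) =
    (\prod_(i <- J) P (Xs i @^-1` A i))%E.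

Definition iid_copies (X : Omega -> S) (Xs : nat -> Omega -> S) : Prop :=
  [/\ forall i, order_measurable (Xs i),
      forall i, same_law (Xs i) X &
      mutually_independent Xs].

Definition prob (A : set Omega) : R := fine (P A).

Definition cond_prob (A B : set Omega) : R := prob (A `&` B) / prob B.

Definition prob_comparison (X : Omega -> S) (x : S) : R :=
  prob (X @^-1` comparable_set x).

Definition quantile_index (X : Omega -> S) (x : S) : R :=
  cond_prob (X @^-1` down_set x) (X @^-1` comparable_set x).

End random_elements.

(* The sample of size n consists of Xs 0, ..., Xs (n - 1). *)
Section empirical.
Context {Omega : Type} {dS : Order.disp_t} {S : porderType dS} {R : realType}.
Variable Xs : nat -> Omega -> S.

Definition emp (n : nat) (w : Omega) (A : set S) : R :=
  n%:R^-1 * \sum_(i < n) \1_A (Xs i w).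

Definition emp_cond (n : nat) (w : Omega) (A B : set S) : R :=
  if 0 < emp n w B then emp n w (A `&` B) / emp n w B else 0.

Definition emp_prob_comparison (n : nat) (w : Omega) (x : S) : R :=
  emp n w (comparable_set x).

Definition emp_quantile_index (n : nat) (w : Omega) (x : S) : R :=
  emp_cond n w (down_set x) (comparable_set x).

End empirical.

(* Supremum in [0, +oo] of a nonnegative function; adding 0 only makes the
   supremum over the empty set 0 instead of -oo. *)
Definition nneg_sup {T : Type} {R : realType} (D : set T) (f : T -> R)
    : \bar R :=
  ereal_sup (0%E |` [set (f x)%:E | x in D]).

(* Y_n = O_P(r_n). Suprema over an arbitrary S need not be measurable, hence
   the outer probability mu_ext P, which agrees with P on measurable sets. *)
Definition bigO_P {d : measure_display} {Omega : measurableType d}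
    {R : realType} (P : probability Omega R)
    (Y : nat -> Omega -> \bar R) (r : nat -> R) : Prop :=
  forall eps : R, 0 < eps ->
  exists2 M : R, 0 < M &
    \forall n \near \oo,
      (mu_ext P [set w | (M * r n)%:E < `|Y n w| ] <= eps%:E)%E.

Section regularity.
Context {d : measure_display} {Omega : measurableType d}.
Context {dS : Order.disp_t} {S : porderType dS}.
Context {R : realType} (P : probability Omega R).
Variables (X : Omega -> S) (Xs : nat -> Omega -> S).

Definition sup_relative_error (n : nat) (p : R) (w : Omega) : \bar R :=
  nneg_sup [set x | p <= prob_comparison P X x] (fun x =>
    let px := prob_comparison P X x in
    Num.max
      `|(emp Xs n w (down_set x) - prob P (X @^-1` down_set x)) / px|
      (Num.max
        `|(emp Xs n w (up_set x) - prob P (X @^-1` up_set x)) / px|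
        `|(emp_prob_comparison Xs n w x - px) / px|)).

Definition sup_index_error (n : nat) (p : R) (w : Omega) : \bar R :=
  nneg_sup [set x | p <= prob_comparison P X x] (fun x =>
    `|emp_quantile_index Xs n w x - quantile_index P X x|).

(* Both pbar and v = v(pbar) may depend on n, hence are sequences. *)
Definition regular_partial_order (pbar v : nat -> R) : Prop :=
  (forall n, 0 < v n) /\
  bigO_P P (fun n => sup_relative_error n (pbar n))
    (fun n => Num.sqrt (v n / n%:R)).

End regularity.

(* Main.v *)
(** With D = P(X <= x), p = p_x and hatted empirical versions,
      D^/p^ - D/p = (D^ - D)/p + (D^/p^) (p - p^)/p,
    and 0 <= D^ <= p^, so the index error at x is at most twice the relative
    error at x, for every sample. (When p^ = 0 also D^ = 0, and the index error
    is |D/p| = |D^ - D|/p.) Hence the two suprema satisfy the same inequality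
    pointwise, and the O_P bound is transferred by monotonicity of the outer
    probability. *)
Require Import Defs.
From mathcomp Require Import all_boot all_order all_algebra.
From mathcomp Require Import all_classical all_reals all_analysis.
From mathcomp Require Import ring lra.

Import Order.TTheory GRing.Theory Num.Theory.

Local Open Scope classical_set_scope.
Local Open Scope ring_scope.

Lemma down_setI_comparable {dS : Order.disp_t} {S : porderType dS} (x : S) :
  down_set x `&` comparable_set x = down_set x.
Proof. by apply/setIidPl => y /= yx; rewrite /comparable_set /= ge_comparable. Qed.

Lemma emp_ge0 {Omega : Type} {dS : Order.disp_t} {S : porderType dS}
    {R : realType} (Xs : nat -> Omega -> S) n w (A : set S) :
  0 <= emp (R := R) Xs n w A.
Proof. by rewrite mulr_ge0 ?invr_ge0 // sumr_ge0. Qed.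

Lemma le_emp {Omega : Type} {dS : Order.disp_t} {S : porderType dS}
    {R : realType} (Xs : nat -> Omega -> S) n w (A B : set S) :
  A `<=` B -> emp (R := R) Xs n w A <= emp Xs n w B.
Proof.
move=> AB; rewrite ler_wpM2l ?invr_ge0 // ler_sum // => i _.
rewrite !indicE ler_nat; case: (boolP (_ \in A)) => // /set_mem /AB.
by move=> /mem_set ->.
Qed.

(** The bound at one fixed point and sample: [a] and [b] stand for the empirical D^ and p^, and the
    [if] is the convention of [emp_cond]. *)
Lemma ratio_error_le {R : realFieldType} (a b D p e : R) :
  0 <= a -> a <= b -> 0 < p ->
  `|(a - D) / p| <= e -> `|(b - p) / p| <= e ->
  `|(if 0 < b then a / b else 0) - D / p| <= 2 * e.
Proof.
move=> a0 ab p0 De pe; have e0 : 0 <= e := le_trans (normr_ge0 _) De.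
case: ltP => [b0|b0].
  have -> : a / b - D / p = (a - D) / p - a / b * ((b - p) / p).
    by field; rewrite !gt_eqF.
  rewrite (le_trans (ler_normB _ _))// mulr_natl mulr2n lerD//.
  (* The factor [a / b] lies in [0, 1], so the second term also costs at most [e]. *)
  rewrite normrM (le_trans _ pe)// ler_piMl// ger0_norm ?divr_ge0 ?(ltW b0)//.
  by rewrite ler_pdivrMr// mul1r.
have aE : a = 0 by apply/le_anti; rewrite a0 (le_trans ab b0).
by move: De; rewrite aE !sub0r mulNr => /le_trans; apply; lra.
Qed.

Lemma nneg_sup_ge0 {T : Type} {R : realType} (D : set T) (f : T -> R) :
  (0 <= nneg_sup D f)%E.
Proof. by apply: ereal_sup_ubound; left. Qed.

Lemma nneg_sup_leM {T : Type} {R : realType} (D : set T) (f g : T -> R)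
    (c : R) :
  0 <= c -> (forall x, D x -> f x <= c * g x) ->
  (nneg_sup D f <= c%:E * nneg_sup D g)%E.
Proof.
(* The adjoined point 0 is a separate case, settled by [0 <= c]. *)
move=> c0 fg; apply: ge_ereal_sup => _ [->|[x Dx <-]].
  by rewrite mule_ge0 ?nneg_sup_ge0.
apply: (@le_trans _ _ (c%:E * (g x)%:E)%E); first by rewrite -EFinM lee_fin fg.
by rewrite lee_wpmul2l ?lee_fin// ereal_sup_ubound//; right; exists x.
Qed.

(** Where [Y] exceeds [c * M * r] in absolute value, [Z] exceeds [M * r], so [c * M] serves for [Y]
    with the same [eps]. *)
Lemma bigO_P_leM {d : measure_display} {Omega : measurableType d}
    {R : realType} (P : probability Omega R) (Y Z : nat -> Omega -> \bar R)
    (r : nat -> R) (c : R) :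
  0 < c -> (forall n w, `|Y n w| <= c%:E * `|Z n w|)%E ->
  bigO_P P Z r -> bigO_P P Y r.
Proof.
move=> c0 YZ Zr eps eps0; have [M M0 ZM] := Zr eps eps0.
exists (c * M); first exact: mulr_gt0.
apply: filterS ZM => n; apply: le_trans.
apply: le_outer_measure => w /= /lt_le_trans /(_ (YZ n w)).
by rewrite -mulrA EFinM lte_pmul2l// lte_fin.
Qed.

Theorem theorem1 (d : measure_display) (Omega : measurableType d)
    (R : realType) (P : probability Omega R)
    (dS : Order.disp_t) (S : porderType dS)
    (X : Omega -> S) (Xs : nat -> Omega -> S)
    (X_meas : order_measurable X)
    (sampling : iid_copies P X Xs)
    (pbar v : nat -> R)
    (pbar_01 : forall n, 0 < pbar n < 1)
    (regular : regular_partial_order P X Xs pbar v) :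
  bigO_P P (fun n => sup_index_error P X Xs n (pbar n))
    (fun n => Num.sqrt (v n / n%:R)).
Proof.
apply: (@bigO_P_leM _ _ _ _ _ _ _ 2) regular.2 => // n w.
rewrite !gee0_abs ?nneg_sup_ge0//; apply: nneg_sup_leM => // x /= px.
have p0 : 0 < prob_comparison P X x.
  by apply: lt_le_trans px; case/andP: (pbar_01 n).
rewrite /emp_quantile_index /emp_cond /quantile_index /cond_prob.
(* Points below [x] are comparable with [x], so both numerators, empirical and true, reduce to the
   down-set of [x]. *)
rewrite -preimage_setI down_setI_comparable.
apply: ratio_error_le => //; first exact: emp_ge0.
- by apply: le_emp; rewrite -down_setI_comparable; apply: subIsetr.
- by rewrite le_max lexx.
- by rewrite !le_max lexx !orbT.
Qed.
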